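(* Let $X,Y$ be real Banach spaces, let $T\in\mathcal{L}(X,Y)$, and let $\mathcal{I},\mathcal{J}$ be ideals on $\omega$. Then a matrix $A=(A_{n,k}:n,k\in\omega)$ of (not necessarily bounded) linear operators in $\mathcal{L}(X,Y)$ is $(\mathcal{I},\mathcal{J})$-regular with respect to $T$ if and only if there exists $k_0\in\omega$ such that all of the following hold: (T1) $\sup_n\|A_{n,\ge k_0}\|<\infty$; (T2) $\sup_n\|A_{n,k}x\|<\infty$ for all $x\in X$ and all $k<k_0$; (T3) $\sum_k A_{n,k}x_k$ converges in the norm of $Y$ for all $\boldsymbol{x}\in c^b(X,\mathcal{I})$ and all $n\in\omega$; (T4) $\mathcal{J}\text{-}\lim_n\sum_k A_{n,k}=T$; (T5) $A\in(c_{00}^b(X,\mathcal{I}),c_0(Y,\mathcal{J}))$. In addition, if each $A_{n,k}$ is bounded, it is possible to choose $k_0=0$.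
   Context: $\omega$ is the set of nonnegative integers. An ideal $\mathcal{I}$ on $\omega$ is a family of subsets of $\omega$ closed under subsets and finite unions; every ideal is assumed to contain the family $\mathrm{Fin}$ of finite sets and to differ from the power set of $\omega$. For a sequence $\boldsymbol{x}=(x_n)$ in a Banach space $V$, $\mathcal{I}\text{-}\lim\boldsymbol{x}=\eta$ means $\{n: x_n\notin U\}\in\mathcal{I}$ for every neighborhood $U$ of $\eta$. Sequence spaces: $\ell_\infty(V)$ is the space of norm-bounded sequences in $V$; $c(V,\mathcal{I})$ the $\mathcal{I}$-convergent sequences; $c_0(V,\mathcal{I})$ those with $\mathcal{I}$-limit $0$; $c_{00}(V,\mathcal{I})$ those with $\{n:x_n\ne0\}\in\mathcal{I}$; $c^b(V,\mathcal{I})=c(V,\mathcal{I})\cap\ell_\infty(V)$, $c_{00}^b(V,\mathcal{I})=c_{00}(V,\mathcal{I})\cap\ell_\infty(V)$. $\mathcal{L}(X,Y)$ is the space of all linear operators $X\to Y$ (not necessarily bounded), with the strong operator topology (pointwise norm convergence). For $E\subseteq\omega$, the group norm of $A_{n,E}=(A_{n,k}:k\in E)$ is $\|A_{n,E}\|=\sup\{\|\sum_{k\in F}A_{n,k}x_k\|: F\subseteq E\text{ finite},\ x_k\in X,\ \|x_k\|\le1\}\in[0,\infty]$; $A_{n,\ge k}=A_{n,\{k,k+1,\dots\}}$. For $\boldsymbol{x}\in X^\omega$, $A\boldsymbol{x}=(A_n\boldsymbol{x})_n$ with $A_n\boldsymbol{x}=\sum_kA_{n,k}x_k$, provided each series converges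 in norm. For $\mathscr{A}\subseteq X^\omega$, $\mathscr{B}\subseteq Y^\omega$, $A\in(\mathscr{A},\mathscr{B})$ means that for every $\boldsymbol{x}\in\mathscr{A}$, $A\boldsymbol{x}$ is well defined and lies in $\mathscr{B}$. $A$ is $(\mathcal{I},\mathcal{J})$-regular with respect to $T$ if $A\in(c^b(X,\mathcal{I}),c^b(Y,\mathcal{J}))$ and $\mathcal{J}\text{-}\lim A\boldsymbol{x}=T(\mathcal{I}\text{-}\lim\boldsymbol{x})$ for all $\boldsymbol{x}\in c^b(X,\mathcal{I})$. The condition $\mathcal{J}\text{-}\lim_n\sum_kA_{n,k}=T$ means: for all $x\in X$ and $n\in\omega$ the series $\sum_kA_{n,k}x$ converges in norm, and $\mathcal{J}\text{-}\lim_n\sum_kA_{n,k}x=Tx$ for all $x\in X$. *)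

(* Defs.v *)
From HB Require Import structures.
From mathcomp Require Import all_boot all_order all_algebra finmap.
From mathcomp Require Import all_classical all_reals all_analysis.

Set Implicit Arguments.
Unset Strict Implicit.
Unset Printing Implicit Defensive.

Import Order.TTheory GRing.Theory Num.Theory.
Import numFieldNormedType.Exports.

Local Open Scope classical_set_scope.
Local Open Scope ring_scope.

Record is_ideal (I : set (set nat)) : Prop := IsIdeal {
  ideal_subset : forall A B, A `<=` B -> I B -> I A ;
  ideal_setU : forall A B, I A -> I B -> I (A `|` B) ;
  ideal_finite : forall A, finite_set A -> I A ;
  ideal_proper : I <> setT
}.

Section SequenceSpaces.
Context {R : realType} (V : completeNormedModType R).
Implicit Types (I : set (set nat)) (x : nat -> V).

(* [ideal_lim I x eta] is the relation "I-lim x = eta". *)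
Definition ideal_lim I x (eta : V) : Prop :=
  forall U : set V, nbhs eta U -> I [set n | ~ U (x n)].

Definition linfty : set (nat -> V) := [set x | bounded_fun x].

Definition c_ I : set (nat -> V) := [set x | exists eta, ideal_lim I x eta].

Definition c0 I : set (nat -> V) := [set x | ideal_lim I x 0].

Definition c00 I : set (nat -> V) := [set x | I [set n | x n != 0]].

Definition cb I : set (nat -> V) := c_ I `&` linfty.

Definition c00b I : set (nat -> V) := c00 I `&` linfty.

End SequenceSpaces.

Arguments linfty {R} V.
Arguments c_ {R} V I.
Arguments c0 {R} V I.
Arguments c00 {R} V I.
Arguments cb {R} V I.
Arguments c00b {R} V I.

Section Matrices.
Context {R : realType} {X Y : completeNormedModType R}.
Implicit Types (A : nat -> nat -> {linear X -> Y}) (x : nat -> X).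
Implicit Types (I J : set (set nat)) (T : {linear X -> Y}).

(* The norm of the group (B_k : k in E), as an element of [0, +oo]. *)
Definition group_norm (B : nat -> {linear X -> Y}) (E : set nat) : \bar R :=
  ereal_sup [set r : \bar R | exists (F : {fset nat}) (x : nat -> X),
    [/\ [set` F] `<=` E, forall k, `|x k| <= 1 &
        r = `|\sum_(k <- F) B k (x k)|%:E]].

(* Convergence in norm of the series defining A_n x. *)
Definition row_cvg A x (n : nat) : Prop :=
  cvgn (series (fun k => A n k (x k))).

(* The sequence Ax; meaningful only when [row_cvg A x n] for every n. *)
Definition transform A x : nat -> Y :=
  fun n => limn (series (fun k => A n k (x k))).

(* A \in (SX, SY) *)
Definition maps_into A (SX : set (nat -> X)) (SY : set (nat -> Y)) : Prop :=
  forall x, SX x -> (forall n, row_cvg A x n) /\ SY (transform A x).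

Definition regular I J T A : Prop :=
  maps_into A (cb X I) (cb Y J) /\
  forall x, cb X I x ->
    forall eta, ideal_lim I x eta -> ideal_lim J (transform A x) (T eta).

(* J-lim_n \sum_k A_{n,k} = T, in the strong operator topology *)
Definition row_sums_lim J T A : Prop :=
  (forall (x : X) n, cvgn (series (fun k => A n k x))) /\
  (forall x : X, ideal_lim J (fun n => limn (series (fun k => A n k x))) (T x)).

Record regularity_conditions I J T A (k0 : nat) : Prop := {
  cond_T1 : (ereal_sup (range (fun n =>
               group_norm (A n) [set k | (k0 <= k)%N])) < +oo)%E ;
  cond_T2 : forall (x : X) k, (k < k0)%N ->
              (ereal_sup (range (fun n => `|A n k x|%:E)) < +oo)%E ;
  cond_T3 : forall x n, cb X I x -> row_cvg A x n ;
  cond_T4 : row_sums_lim J T A ;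
  cond_T5 : maps_into A (c00b X I) (c0 Y J)
}.

End Matrices.

(* Main.v *)
Require Import Defs.
From mathcomp Require Import all_boot all_order all_algebra finmap.
From mathcomp Require Import all_classical all_reals all_analysis.
From mathcomp Require Import lra.
Import Order.TTheory GRing.Theory Num.Theory.
Import numFieldNormedType.Exports.
Local Open Scope classical_set_scope.
Local Open Scope ring_scope.

(** Necessity.  Since the ideal contains all finite sets, a regular matrix maps
    null sequences to bounded sequences, and the heart of the matter is that
    this alone forces the tails of the rows, from some column on, to have
    uniformly bounded group norms.  The operators may be unbounded, so no
    Banach space of sequences is at hand on which Banach-Steinhaus could be
    used; instead a gliding hump is built ([gliding_hump]).  If no tail were
    uniformly bounded, one could add blocks of smaller and smaller vectors, each
    further out than the previous ones and each making some row large, with a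
    sign chosen so that the earlier blocks do not cancel it.  The blocks form a
    null sequence with unbounded transform, provided that the later blocks do
    not spoil what was achieved on an earlier row.  They do not, because every
    single row has some tail of finite group norm ([row_tail_bound]); and this
    follows from the same gliding hump argument, applied to the matrix of the
    truncations of that row.  The other conditions come from testing regularity
    on constant sequences, on sequences with one nonzero entry and on bounded
    sequences supported on a set of the ideal.

    Sufficiency ([conditions_lim]).  If x has limit eta along the ideal, then
    x - eta is the sum of a bounded sequence supported on a set of the ideal,
    which may be taken to contain the finitely many uncontrolled columns, and of
    a sequence that is uniformly small and vanishes on those columns.  The
    transform of the first tends to 0 by hypothesis, and that of the second is
    small by the bound on the tails.

    If every operator is bounded, then each column, being pointwise bounded, is
    uniformly bounded by Banach-Steinhaus ([column_bound]), so the finitely many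
    uncontrolled columns can be absorbed into the tail one by one
    ([tail_bound_prev]). *)

(** * Group norms of row tails *)

Section TailBounds.
Context {R : realType} {X Y : completeNormedModType R}.
Implicit Types (B : nat -> {linear X -> Y}) (x : nat -> X).

(** A real-valued form of the bound M on the group norm of the B_k with
    k >= p.  Sequences vanishing below p, summed from 0, replace finite subsets
    of [p, oo): enlarging p only restricts the admissible sequences, and the
    sums are partial sums of the series that define the transform. *)
Definition tail_bound B (p : nat) (M : R) : Prop :=
  forall x q, (forall k, `|x k| <= 1) -> (forall k, (k < p)%N -> x k = 0) ->
    `|series (fun k => B k (x k)) q| <= M.

Lemma tail_boundW B p p' M M' :
  (p <= p')%N -> M <= M' -> tail_bound B p M -> tail_bound B p' M'.
Proof.
move=> pp' MM' BM x q x1 x0; apply: le_trans MM'; apply: BM => // k kp.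
by apply: x0; exact: leq_trans pp'.
Qed.

(** A sum over a finite set F is a partial sum of the sequence that is set to 0
    outside F; conversely the partial sum up to q is the sum over
    F = {p, .., q-1}. *)
Lemma group_norm_leP B p M :
  (group_norm B [set k | (p <= k)%N] <= M%:E)%E <-> tail_bound B p M.
Proof.
split=> [BM x q x1 x0|BM].
  pose F := [fset k in iota 0 q | (p <= k)%N]%fset.
  have sumF : series (fun k => B k (x k)) q = \sum_(k <- F) B k (x k).
    rewrite /series /= (bigID (fun k => (p <= k)%N)) /= addrC big1; last first.
      by move=> k; rewrite -ltnNge => /x0 ->; rewrite linear0.
    rewrite add0r -big_filter; apply: perm_big; apply: uniq_perm.
    - by rewrite filter_uniq// iota_uniq.
    - exact: fset_uniq.
    - by move=> k; rewrite /F mem_filter !inE /= andbC /index_iota subn0.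
  rewrite -lee_fin; apply: le_trans BM; apply: ereal_sup_ubound.
  exists F, x; split=> //; last by rewrite sumF.
  by move=> k /=; rewrite !inE => /andP[].
apply: ge_ereal_sup => _ [F [x [Fp x1 ->]]]; rewrite lee_fin.
(* Any partial sum reaching beyond the maximum of F equals the sum over F. *)
pose y k := if k \in F then x k else 0.
have -> : \sum_(k <- F) B k (x k) =
    series (fun k => B k (y k)) (\max_(k <- F) k).+1.
  rewrite /series /= [RHS](bigID (fun k => k \in F)) /= [X in _ = _ + X]big1.
    rewrite addr0 -[RHS]big_filter.
    rewrite (eq_big_seq (fun k => B k (y k))); last by move=> k kF; rewrite /y kF.
    apply: perm_big; apply: uniq_perm.
    - exact: fset_uniq.
    - by rewrite filter_uniq// iota_uniq.
    - move=> k; rewrite mem_filter mem_index_iota /=.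
      case kF : (k \in F) => //=; apply/esym; rewrite ltnS.
      exact: (@leq_bigmax_seq _ _ predT id).
  by move=> k /negbTE kF; rewrite /y kF linear0.
apply: BM => k; rewrite /y; case: ifPn => // kF; first by rewrite normr0.
by move=> kp; have /= := Fp _ kF; rewrite leqNgt kp.
Qed.

Lemma tail_bound_scale B p M x q e : tail_bound B p M -> 0 < e ->
  (forall k, `|x k| <= e) -> (forall k, (k < p)%N -> x k = 0) ->
  `|series (fun k => B k (x k)) q| <= e * M.
Proof.
move=> BM e0 xe x0; rewrite mulrC -ler_pdivrMr//.
have -> : `|series (fun k => B k (x k)) q| / e =
    `|series (fun k => B k (e^-1 *: x k)) q|.
  under [in RHS]eq_fun do rewrite linearZ.
  rewrite [X in _ = `|X|](_ : _ = e^-1 *: series (fun k => B k (x k)) q).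
    by rewrite normrZ gtr0_norm ?invr_gt0// mulrC.
  by rewrite /series /= scaler_sumr.
apply: BM => k; last by move=> /x0 ->; rewrite scaler0.
by rewrite normrZ gtr0_norm ?invr_gt0// mulrC ler_pdivrMr// mul1r.
Qed.

End TailBounds.

(** * The gliding hump *)

Section Hump.
Context {R : realType} {X Y : completeNormedModType R}.
Implicit Types (A : nat -> nat -> {linear X -> Y}) (x : nat -> X).

(** The partial sums of the tail all lie in the closed ball of radius e * M, so
    the limit does too. *)
Lemma transform_tail A x n p M e : tail_bound (A n) p M -> 0 < e ->
  (forall k, (p <= k)%N -> `|x k| <= e) -> row_cvg A x n ->
  `|transform A x n - series (fun k => A n k (x k)) p| <= e * M.
Proof.
move=> AM e0 xe cx; set s := series _.
pose y k := if (k < p)%N then 0 else x k.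
apply: (@cvgr_to_le _ \oo _ _ (fun q => `|s q - s p|)).
  by apply: cvg_norm; apply: cvgB; [exact: cx|exact: cvg_cst].
exists p => // q /= pq; rewrite sub_series_geq//.
have -> : \sum_(p <= k < q) A n k (x k) = series (fun k => A n k (y k)) q.
  rewrite /series /= [RHS](@big_cat_nat _ _ _ p)//= [X in _ = X + _]big_nat.
  rewrite [X in _ = X + _]big1 ?add0r.
    by apply: eq_big_nat => k /andP[pk _]; rewrite /y ltnNge pk.
  by move=> k /andP[_ kp]; rewrite /y kp linear0.
apply: (tail_bound_scale _ _ _ _ _ _ AM e0) => k; rewrite /y; last by move=> ->.
by case: ltnP => [_|/xe//]; rewrite normr0 ltW.
Qed.

Lemma bounded_seqP {V : completeNormedModType R} (u : nat -> V) :
  linfty V u <-> exists M, forall n, `|u n| <= M.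
Proof.
have pf : ProperFilter (globally [set: nat]).
  exact: (@globally_properfilter _ _ 0%N).
rewrite /linfty /= ex_bound.
by split=> -[M uM]; exists M => n; [exact: uM|move=> _; exact: uM].
Qed.

(** A stage of the construction: the entries of [hump_seq] below [hump_end] are
    final, later entries will have norm at most [hump_eps], and [hump_row] is
    the row on which the last block is large. *)
Record hump := Hump {
  hump_seq : nat -> X ;
  hump_end : nat ;
  hump_eps : {posnum R} ;
  hump_row : nat
}.

(** The new row is at least 1 + hump_end s on what is fixed so far.  Since
    hump_end grows at least by one per step, this also makes the values
    unbounded and, through the second bound on the new [hump_eps], makes the
    entries tend to 0.  The last clause caps by 1 whatever later stages can
    contribute to the row [hump_row t]. *)
Definition hump_step A (s t : hump) : Prop :=
  [/\ (hump_end s < hump_end t)%N,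
      forall k, (k < hump_end s)%N -> hump_seq t k = hump_seq s k,
      forall k, (hump_end s <= k)%N -> `|hump_seq t k| <= (hump_eps s)%:num,
      1 + (hump_end s)%:R <= `|series (fun k =>
        A (hump_row t) k (hump_seq t k)) (hump_end t)| &
      [/\ (hump_eps t)%:num <= (hump_eps s)%:num,
          (hump_eps t)%:num <= (hump_end t).+1%:R^-1 &
          tail_bound (A (hump_row t)) (hump_end t) (hump_eps t)%:num^-1]].

(** With a free choice of sign, adding v to u cannot cancel v: the two sums
    differ by 2 v.  The next hump can therefore be chosen regardless of the
    values that the earlier ones produce. *)
Lemma max_norm_addB (u v : Y) (c : R) :
  c <= `|v| -> exists s : bool, c <= `|u + (-1) ^+ s *: v|.
Proof.
move=> cv; have [|vc] := leP c `|u + v|.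
  by exists false; rewrite expr0 scale1r.
exists true; rewrite expr1 scaleN1r leNgt; apply/negP => uvc.
have : `|v + v| <= `|u + v| + `|u - v|.
  rewrite (le_trans _ (ler_normB _ _))//.
  by rewrite opprB [X in _ <= `|X|]addrC addrA subrK.
rewrite -mulr2n normrMn mulr2n => h.
by move: (lt_le_trans (ltrD vc uvc) (lerD cv cv)); lra.
Qed.

Lemma seriesDl (B : nat -> {linear X -> Y}) u z a q :
  series (fun k => B k (u k + a *: z k)) q =
  series (fun k => B k (u k)) q + a *: series (fun k => B k (z k)) q.
Proof.
rewrite /series /= scaler_sumr -big_split; apply: eq_bigr => k _.
by rewrite linearD linearZ.
Qed.

Lemma series_cut (B : nat -> {linear X -> Y}) x p q : (p <= q)%N ->
  series (fun k => B k (if (k < p)%N then x k else 0)) q =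
  series (fun k => B k (x k)) p.
Proof.
move=> pq; rewrite /series /= (@big_cat_nat _ _ _ p)//=.
rewrite [X in _ + X]big_nat [X in _ + X]big1 ?addr0.
  by apply: eq_big_nat => k /andP[_ ->].
by move=> k /andP[pk _]; rewrite ltnNge pk linear0.
Qed.

(** If no tail is bounded uniformly in the rows, then beyond [hump_end] some row
    n is large on a finite block with entries in the unit ball, hence still
    large after scaling the block by [hump_eps].  Row n by itself has a bounded
    tail, which decides how far the new end must go and how small the new
    [hump_eps] must be. *)
Lemma exists_hump_step A :
  (forall n, exists p M, tail_bound (A n) p M) ->
  ~ (exists p M, forall n, tail_bound (A n) p M) ->
  forall s, exists t, hump_step A s t.
Proof.
move=> Afin Ainf [w p e m].
have [n [x [q [x1 x0 xq]]]] : exists n x q, [/\ forall k, `|x k| <= 1,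
    forall k, (k < p)%N -> x k = 0 &
    e%:num^-1 * (1 + p%:R) < `|series (fun k => A n k (x k)) q|].
  apply: contra_notP Ainf => nope.
  (* The factor e^-1 makes up for scaling the block into the ball of radius e. *)
  exists p, (e%:num^-1 * (1 + p%:R)) => n x q x1 x0.
  by rewrite leNgt; apply/negP => xq; apply: nope; exists n, x, q.
have [p0 [M0 AM0]] := Afin n.
(* The new end is past the block, inside the bounded tail of row n, and past p. *)
pose p' := maxn (maxn q p0) p.+1.
pose u k := if (k < p)%N then w k else 0.
pose z k := e%:num *: (if (k < q)%N then x k else 0).
have zp' : `|series (fun k => A n k (z k)) p'| >= 1 + p%:R.
  have -> : series (fun k => A n k (z k)) p' =
      e%:num *: series (fun k => A n k (x k)) q.
    rewrite -(@series_cut _ x q p') ?leq_max ?leqnn//.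
    by rewrite /series /= scaler_sumr; apply: eq_bigr => k _; rewrite linearZ.
  by rewrite normrZ gtr0_norm// -ler_pdivrMl// ltW.
have [s us] := max_norm_addB (series (fun k => A n k (u k)) p') _ _ zp'.
have e'0 : 0 < Num.min e%:num (Num.min p'.+1%:R^-1 (`|M0| + 1)^-1).
  by rewrite !lt_min invr_gt0 ltr0n invr_gt0 ltr_wpDl//= andbT.
exists (Hump (fun k => u k + (-1) ^+ s *: z k) p' (PosNum e'0) n).
split=> /=.
- by rewrite leq_max leqnn orbT.
- move=> k kp; rewrite /u kp /z x0// if_same scaler0 scaler0.
  by rewrite addr0.
- move=> k pk; rewrite /u ltnNge pk /= add0r normrZ normrX normrN1 expr1n mul1r.
  rewrite normrZ gtr0_norm// ler_piMr//.
  by case: ifP => // _; rewrite normr0.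
- by rewrite seriesDl.
- split; [by rewrite ge_min lexx|by rewrite !ge_min lexx orbT|].
  apply: tail_boundW AM0; first by rewrite !leq_max leqnn orbT.
  rewrite (le_trans (ler_norm M0))// (le_trans _ (_ : `|M0| + 1 <= _))//.
    by rewrite lerDl.
  rewrite -[leLHS]invrK lef_pV2 ?posrE ?invr_gt0 ?ltr_wpDl//.
  by rewrite !ge_min lexx !orbT.
Qed.

(** The humps are glued into one null sequence x.  On the row chosen at stage j,
    the entries of x below the new end contribute at least 1 + j and the later
    ones at most 1, so the transform of x is unbounded. *)
Lemma gliding_hump A :
  (forall n, exists p M, tail_bound (A n) p M) ->
  (forall x, x @ \oo --> 0 ->
    (forall n, row_cvg A x n) /\ linfty Y (transform A x)) ->
  exists p M, forall n, tail_bound (A n) p M.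
Proof.
move=> Afin A0; apply: contrapT => Ainf.
have step s : {t | hump_step A s t}.
  by apply: cid; exact: exists_hump_step.
have [f [_ fS]] := dependent_choice step (Hump (fun=> 0) 0 1%:pos 0).
pose p j := hump_end (f j); pose e j := (hump_eps (f j))%:num.
pose w j := hump_seq (f j).
have e_gt0 j : 0 < e j by rewrite /e.
have pS j : (p j < p j.+1)%N by case: (fS j).
have p_ge j : (j <= p j)%N.
  by elim: j => // j IH; exact: leq_ltn_trans IH (pS j).
have p_mono : {homo p : i j / (i <= j)%N}.
  by apply: homo_leq => //; [exact: leq_trans|move=> i; exact: ltnW].
have wS j k : (k < p j)%N -> w j.+1 k = w j k by case: (fS j) => _ + _ _ _; apply.
have w_stable i j k : (j <= i)%N -> (k < p j)%N -> w i k = w j k.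
  move=> /subnK <-; elim: (i - j)%N => // d IH kp.
  by rewrite addSn wS ?IH// (leq_trans kp)// p_mono// leq_addl.
have e_mono i j : (j <= i)%N -> e i <= e j.
  move=> /subnK <-; elim: (i - j)%N => // d IH.
  by apply: le_trans IH; rewrite addSn; case: (fS (d + j)%N) => _ _ _ _ [].
(* Entry k is final at stage k+1, since the end of stage j is at least j. *)
pose x k := w k.+1 k.
have xw j k : (k < p j)%N -> x k = w j k.
  move=> kp; rewrite /x; have [jk|kj] := leqP j k.
    by apply: w_stable => //; exact: leqW.
  by apply/esym/w_stable => //; exact: p_ge.
have xe j k : (p j <= k)%N -> `|x k| <= e j.
  move=> pk.
  suff we i : (j <= i)%N -> (k < p i)%N -> `|w i k| <= e j.
    by apply: we; [apply/leqW/(leq_trans _ pk); exact: p_ge|exact: p_ge].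
  move=> /subnK <-; elim: (i - j)%N => [|d IH]; first by rewrite add0n ltnNge pk.
  rewrite addSn => _; have [kp|kp] := ltnP k (p (d + j)%N).
    by rewrite wS// IH.
  apply: (@le_trans _ _ (e (d + j)%N)); last by apply: e_mono; rewrite leq_addl.
  by case: (fS (d + j)%N) => _ _ + _ _; apply.
(* The entries beyond the end of stage j+1 are at most 1 / (j + 2). *)
have x0 : x @ \oo --> 0.
  apply/cvgr0Pnorm_le => r r0.
  have [j jr] : exists j, j.+1%:R^-1 < r :> R.
    have := archi_boundP (ltW (_ : 0 < r^-1)); rewrite invr_gt0 => /(_ r0) h.
    exists (Num.bound r^-1); rewrite -[ltRHS]invrK ltf_pV2 ?posrE ?invr_gt0//.
    by apply: lt_trans h _; rewrite ltr_nat.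
  exists (p j.+1) => // k /= pk; apply: (le_trans (xe _ _ pk)).
  have [_ _ _ _ [_ ej _]] := fS j.
  apply: (le_trans ej); apply/ltW/(le_lt_trans _ jr).
  by rewrite lef_pV2 ?posrE ?ltr0n// ler_nat ltnS (leq_trans _ (p_ge _)).
have [cx /bounded_seqP[C xC]] := A0 _ x0.
(* Stage j already exceeds the supposed bound C of the transform. *)
pose j := Num.bound `|C|.
have Cj : C < j%:R by exact: le_lt_trans (ler_norm C) (archi_boundP _).
have [_ _ _ big [_ _ small]] := fS j.
have := transform_tail _ _ _ _ _ _ small (e_gt0 _) (fun k => xe j.+1 k) (cx _).
rewrite mulfV ?gt_eqF ?e_gt0//.
have -> : series (fun k => A (hump_row (f j.+1)) k (x k)) (hump_end (f j.+1)) =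
    series (fun k => A (hump_row (f j.+1)) k (w j.+1 k)) (hump_end (f j.+1)).
  by rewrite /series /=; apply: eq_big_nat => k /andP[_ kp]; rewrite (xw j.+1).
move=> h; have := xC (hump_row (f j.+1)).
set s := series _ _ in h; set t := transform _ _ _ in h *.
have st : `|s| <= `|t| + 1.
  by rewrite -lerBlDl (le_trans (lerB_dist _ _))// distrC.
have js : 1 + j%:R <= `|s|.
  by apply: le_trans big; rewrite lerD2l ler_nat p_ge.
by rewrite leNgt => /negP; apply; lra.
Qed.

End Hump.

(** * Uniformly bounded tails of a matrix *)

Section UniformTails.
Context {R : realType} {X Y : completeNormedModType R}.
Implicit Types (A : nat -> nat -> {linear X -> Y}) (x : nat -> X).

Lemma transform_finite A x n p : (forall k, (p <= k)%N -> x k = 0) ->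
  row_cvg A x n /\ transform A x n = series (fun k => A n k (x k)) p.
Proof.
move=> x0; set s := series _.
have sp : s @ \oo --> s p.
  apply: cvg_near_cst; exists p => // q /= pq.
  apply/eqP; rewrite -subr_eq0 /s sub_series_geq// big_nat big1//.
  by move=> k /andP[pk _]; rewrite x0// linear0.
split; first by apply/cvg_ex; exists (s p).
exact: norm_cvg_lim.
Qed.

(** The partial sums of row n are the transform under the matrix B whose m-th
    row is row n cut at m.  They converge, hence are bounded, and the rows of B
    have finite support, so the gliding hump applies to B. *)
Lemma row_tail_bound A n : (forall x, x @ \oo --> 0 -> row_cvg A x n) ->
  exists p M, tail_bound (A n) p M.
Proof.
move=> cA.
pose B m k : {linear X -> Y} := if (k < m)%N then A n k else GRing.null_fun Y.
have Bser x m q : (m <= q)%N ->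
    series (fun k => B m k (x k)) q = series (fun k => A n k (x k)) m.
  move=> mq; rewrite /series /= (@big_cat_nat _ _ _ m)//=.
  rewrite [X in _ + X]big_nat [X in _ + X]big1 ?addr0.
    by apply: eq_big_nat => k /andP[_ km]; rewrite /B km.
  by move=> k /andP[mk _]; rewrite /B ltnNge mk.
have Btr x m : row_cvg B x m /\
    transform B x m = series (fun k => A n k (x k)) m.
  have sm : series (fun k => B m k (x k)) @ \oo --> series (fun k => A n k (x k)) m.
    by apply: cvg_near_cst; exists m => // q /= mq; rewrite Bser.
  split; first by apply/cvg_ex; exists (series (fun k => A n k (x k)) m).
  exact: norm_cvg_lim.
have [m|x x0|p [M BM]] := gliding_hump B.
- exists m, 0 => x q _ x0; rewrite /series /= big1 ?normr0// => k _.
  by rewrite /B; case: ifP => // km; rewrite x0// linear0.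
- split=> [m|]; first by case: (Btr x m).
  rewrite (_ : transform B x = series (fun k => A n k (x k))).
    exact/cvg_seq_bounded/cA.
  by apply/funext => m; case: (Btr x m).
- exists p, M => x q x1 x0.
  by rewrite -(Bser _ _ _ (leqnn q)); exact: BM.
Qed.

(** A Banach-Steinhaus theorem for matrices of unbounded operators: finitely
    many columns escape control, the remaining ones are uniformly bounded as a
    group. *)
Lemma uniform_tail_bound A :
  (forall x, x @ \oo --> 0 ->
    (forall n, row_cvg A x n) /\ linfty Y (transform A x)) ->
  exists p M, forall n, tail_bound (A n) p M.
Proof.
move=> A0; apply: gliding_hump => // n; apply: row_tail_bound => x x0.
by case: (A0 x x0).
Qed.

Lemma sup_lty_bound (u : nat -> \bar R) :
  (ereal_sup (range u) < +oo)%E <-> exists M, forall n, (u n <= M%:E)%E.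
Proof.
split=> [|[M uM]].
  have ub n : (u n <= ereal_sup (range u))%E by apply: ereal_sup_ubound; exists n.
  case: (ereal_sup _) ub => [r|//|] ub _; first by exists r.
  by exists 0 => n; apply: le_trans (ub n) _; rewrite leNye.
apply: (@le_lt_trans _ _ M%:E); last exact: ltry.
by apply: ge_ereal_sup => _ [n _ <-].
Qed.

Lemma sup_group_norm_ltyP A p :
  (ereal_sup (range (fun n => group_norm (A n) [set k | (p <= k)%N])) < +oo)%E
  <-> exists M, forall n, tail_bound (A n) p M.
Proof.
rewrite sup_lty_bound; split=> -[M AM]; exists M => n.
  exact/group_norm_leP.
exact/group_norm_leP.
Qed.

Lemma transformB A x y n : row_cvg A x n -> row_cvg A y n ->
  row_cvg A (fun k => x k - y k) n /\
  transform A (fun k => x k - y k) n = transform A x n - transform A y n.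
Proof.
move=> cx cy.
have h : series (fun k => A n k (x k - y k)) @ \oo -->
    transform A x n - transform A y n.
  rewrite (_ : series _ = series (fun k => A n k (x k)) -
                          series (fun k => A n k (y k))).
    by apply: cvgB; [exact: cx|exact: cy].
  apply/funext => q; rewrite /series /= !fctE -sumrB.
  by apply: eq_bigr => k _; rewrite linearB.
split; first by apply/cvg_ex; eexists; exact: h.
exact: norm_cvg_lim.
Qed.

(** The only step that uses bounded operators: Banach-Steinhaus applies to the
    entries of a single column. *)
Lemma column_bound (f : nat -> {linear X -> Y}) :
  (forall n, bounded_fun_norm (f n)) ->
  (forall v : X, exists M, forall n, `|f n v| <= M) ->
  exists M, forall n (v : X), `|v| <= 1 -> `|f n v| <= M.
Proof.
move=> fb fp.
have fam g : range (fun n => f n : X -> Y) g -> bounded_fun_norm g /\ linear g.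
  by move=> [n _ <-]; split=> //; exact: linearP.
have pw : pointwise_bounded (range (fun n => f n : X -> Y)).
  by move=> v; have [M fM] := fp v; exists M => _ [n _ <-].
have [M fM] := Banach_Steinhauss fam pw 1.
by exists M => n v v1; apply: fM => //; exists n.
Qed.

(** A uniformly bounded column can be absorbed into the tail; iterating this
    moves the start of a uniformly bounded tail down to 0. *)
Lemma tail_bound_prev A p M C :
  (forall n, tail_bound (A n) p.+1 M) ->
  (forall n (v : X), `|v| <= 1 -> `|A n p v| <= C) ->
  forall n, tail_bound (A n) p (C + M).
Proof.
move=> AM AC n x q x1 x0.
pose y k := if (k < p.+1)%N then 0 else x k.
have yM : `|series (fun k => A n k (y k)) q| <= M.
  apply: AM => k; last by rewrite /y => ->.
  by rewrite /y; case: ifP => // _; rewrite normr0.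
have -> : series (fun k => A n k (x k)) q =
    (if (p < q)%N then A n p (x p) else 0) + series (fun k => A n k (y k)) q.
  rewrite /series /=; case: ifPn => [pq|]; last first.
    rewrite -leqNgt add0r => qp; apply: eq_big_nat => k /andP[_ kq].
    have kp : (k < p)%N by exact: leq_trans qp.
    by rewrite /y (ltnW kp : (k < p.+1)%N) x0.
  rewrite !big_mkord (bigD1 (Ordinal pq)) //= [in RHS](bigD1 (Ordinal pq)) //=.
  rewrite /y ltnSn linear0 add0r; congr (_ + _); apply: eq_bigr => k kp.
  case: ltnP => //; rewrite ltnS leq_eqVlt => /orP[/eqP kpE|/x0 ->//].
  by case/negP: kp; apply/eqP/val_inj.
apply: (le_trans (ler_normD _ _)); apply: lerD => //.
case: ifP => _; first exact: AC.
by rewrite normr0 (le_trans _ (AC n 0 _)) ?normr0.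
Qed.

End UniformTails.

(** * Convergence along an ideal *)

Section Ideals.
Context {R : realType} {V : completeNormedModType R}.
Implicit Types (x : nat -> V) (I : set (set nat)).

Lemma ideal_limP I x eta : is_ideal I -> ideal_lim I x eta <->
  forall e, 0 < e -> I [set n | e <= `|x n - eta|].
Proof.
move=> hI; split=> [xI e e0|xI U /nbhs_ballP[e /= e0 eU]].
  have := xI _ (nbhsx_ballx eta e e0).
  apply: (ideal_subset hI) => n /= en; rewrite -ball_normE /= distrC.
  by apply/negP; rewrite -leNgt.
apply: (ideal_subset hI) (xI e e0) => n /= nU; rewrite leNgt; apply/negP => xe.
by apply: nU; apply: eU; rewrite -ball_normE /= distrC.
Qed.

Lemma finite_ideal I (p : nat) : is_ideal I -> I [set k | (k < p)%N].
Proof. by move=> hI; apply: (ideal_finite hI); exact: finite_II. Qed.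

Lemma cvg0_cb I x : is_ideal I -> x @ \oo --> 0 ->
  ideal_lim I x 0 /\ linfty V x.
Proof.
move=> hI x0; split; last by apply/cvg_seq_bounded/cvg_ex; exists 0.
move=> U /x0 [p _ pU]; apply: (ideal_subset hI) (finite_ideal I p hI) => n /= nU.
by rewrite ltnNge; apply/negP => /pU.
Qed.

Lemma c00_ideal_lim I x : is_ideal I -> c00 V I x -> ideal_lim I x 0.
Proof.
move=> hI xI U /nbhs_singleton U0; apply: (ideal_subset hI) xI => n /= nU.
by apply/eqP => xn; apply: nU; rewrite xn.
Qed.

Lemma cst_ideal_lim I (v : V) : is_ideal I -> ideal_lim I (fun=> v) v.
Proof.
move=> hI U /nbhs_singleton Uv; apply: (ideal_finite hI).
by rewrite (_ : [set _ | _] = set0) //; apply/seteqP; split.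
Qed.

End Ideals.

(** * Regular matrices *)

Section Regularity.
Context {R : realType} {X Y : completeNormedModType R}.
Implicit Types (A : nat -> nat -> {linear X -> Y}) (x : nat -> X).
Implicit Types (I J : set (set nat)) (T : {linear X -> Y}).

(** The sequence with v in position k and 0 elsewhere is null, and its transform
    is column k evaluated at v. *)
Lemma regular_column_bounded I J T A k : is_ideal I -> regular I J T A ->
  forall v : X, exists M, forall n, `|A n k v| <= M.
Proof.
move=> hI [Areg _] v.
pose x j := if j == k then v else 0.
have xk j : (k.+1 <= j)%N -> x j = 0 by rewrite /x => kj; rewrite gtn_eqF.
have x0 : x @ \oo --> 0 by apply: cvg_near_cst; exists k.+1.
have [xI xb] := cvg0_cb I x hI x0.
have [_ [_ /bounded_seqP[M AM]]] := Areg x (conj (ex_intro _ 0 xI) xb).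
exists M => n; suff <- : transform A x n = A n k v by [].
have [_ ->] := transform_finite A x n k.+1 xk.
rewrite seriesSr /series /= big_nat big1 ?add0r /x ?eqxx//.
by move=> j /andP[_ jk]; rewrite ltn_eqF// linear0.
Qed.

Lemma regular_tail_bound I J T A : is_ideal I -> regular I J T A ->
  exists p M, forall n, tail_bound (A n) p M.
Proof.
move=> hI [Areg _]; apply: uniform_tail_bound => x /(cvg0_cb _ _ hI)[xI xb].
by have [cx [_ bx]] := Areg x (conj (ex_intro _ 0 xI) xb).
Qed.

(** Apart from the uniform tail, each condition is regularity applied to a
    particular class of sequences: single-entry sequences, constant sequences,
    and bounded sequences supported on a set of the ideal. *)
Lemma regular_conditions I J T A p : is_ideal I -> regular I J T A ->
  (exists M, forall n, tail_bound (A n) p M) -> regularity_conditions I J T A p.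
Proof.
move=> hI Areg AM; have [Ainto Alim] := Areg.
have cst_cb (v : X) : cb X I (fun=> v).
  split; first by exists v; exact: cst_ideal_lim.
  by apply/bounded_seqP; exists `|v|.
split.
- exact/sup_group_norm_ltyP.
- move=> v k _; apply/sup_lty_bound.
  have [M vM] := regular_column_bounded I J T A k hI Areg v.
  by exists M => n; rewrite lee_fin.
- by move=> x n /Ainto[].
- split=> [v n|v]; first by have [+ _] := Ainto _ (cst_cb v); apply.
  exact: Alim (cst_cb v) _ (cst_ideal_lim _ _ hI).
- move=> x [x0 xb]; have xI := c00_ideal_lim _ _ hI x0.
  have xcb : cb X I x by split=> //; exists 0.
  split; first by case: (Ainto x xcb).
  by rewrite /c0 /= -(linear0 T); exact: Alim.
Qed.

(** The first p terms are bounded column by column, at the fixed entries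
    x_0, .., x_(p-1); the rest is controlled by the group norm of the tail. *)
Lemma conditions_bounded I J T A p x : regularity_conditions I J T A p ->
  cb X I x -> linfty Y (transform A x).
Proof.
move=> [/sup_group_norm_ltyP[M AM] T2 T3 _ _] xcb.
have [_ /bounded_seqP[C xC]] := xcb.
have [D sD] : exists D, forall n, `|series (fun k => A n k (x k)) p| <= D.
  have : forall q, (q <= p)%N ->
      exists D, forall n, `|series (fun k => A n k (x k)) q| <= D.
    elim=> [_|q IH qp].
      by exists 0 => n; rewrite /series /= big_geq// normr0.
    have [D sD] := IH (ltnW qp).
    have /sup_lty_bound[E AE] := T2 (x q) q qp.
    exists (D + E) => n; rewrite seriesSr (le_trans (ler_normD _ _))// lerD//.
    by rewrite -lee_fin.
  by apply.
apply/bounded_seqP; exists ((`|C| + 1) * M + D) => n.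
have := transform_tail A x n p M (`|C| + 1) (AM n) (ltr_wpDl _ _).
move=> /(_ (normr_ge0 _) ltr01) h.
rewrite -[transform A x n](subrK (series (fun k => A n k (x k)) p)).
rewrite (le_trans (ler_normD _ _))// lerD// h//; last exact: T3.
move=> k _; rewrite (le_trans (xC k))// (le_trans (ler_norm C))//.
by rewrite lerDl.
Qed.

(** Up to the constant sequence eta, x splits into y + z, where y is supported
    on the set E of the ideal where x is far from eta, and z is uniformly small.
    The transform of y tends to 0 by hypothesis.  As E also contains
    {0, .., p-1}, z vanishes there, and the group norm of the tail keeps its
    transform small. *)
Lemma conditions_lim I J T A p x eta : is_ideal I -> is_ideal J ->
  regularity_conditions I J T A p -> cb X I x -> ideal_lim I x eta ->
  ideal_lim J (transform A x) (T eta).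
Proof.
move=> hI hJ [/sup_group_norm_ltyP[M AM] _ T3 [T4 T4'] T5] xcb xeta.
(* The size d of z is chosen so that d * M <= e / 3, whatever the sign of M. *)
apply/ideal_limP => // e e0; pose d := e / 3 / (`|M| + 1).
have d0 : 0 < d by rewrite !divr_gt0// ltr_wpDl.
have dM : d * M <= e / 3.
  rewrite /d mulrAC -mulrA ger_pMr ?divr_gt0// ler_pdivrMr ?ltr_wpDl// mul1r.
  by rewrite (le_trans (ler_norm M))// lerDl.
pose E : set nat := [set k | d <= `|x k - eta|] `|` [set k | (k < p)%N].
have EI : I E.
  apply: (ideal_setU hI); last exact: finite_ideal.
  by move/(ideal_limP _ _ _ hI): xeta; apply.
pose y k := if k \in E then x k - eta else 0.
pose z k := x k - eta - y k.
have [cy y0] : (forall n, row_cvg A y n) /\ c0 Y J (transform A y).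
  apply: T5; split.
    apply: (ideal_subset hI) EI => k /=; rewrite /y.
    by case: ifPn => [|_]; rewrite ?eqxx// inE.
  have [_ /bounded_seqP[C xC]] := xcb.
  apply/bounded_seqP; exists (C + `|eta|) => k; rewrite /y; case: ifP => _.
    by rewrite (le_trans (ler_normB _ _))// lerD2r.
  by rewrite normr0 addr_ge0// (le_trans _ (xC 0%N)).
have cx n : row_cvg A x n by exact: T3.
have ceta n : row_cvg A (fun=> eta) n by exact: T4.
have zE k : k \in E -> z k = 0 by move=> kE; rewrite /z /y kE subrr.
have zd k : `|z k| <= d.
  rewrite /z /y; case: ifPn => [_|]; first by rewrite subrr normr0 ltW.
  rewrite subr0 notin_setE => kE; rewrite leNgt; apply/negP => /ltW dk.
  by apply: kE; left.
have Az n : `|transform A z n| <= e / 3 /\ transform A x n =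
    transform A z n + transform A y n + transform A (fun=> eta) n.
  have [c1 t1] := transformB A x (fun=> eta) n (cx n) (ceta n).
  have [c2 t2] := transformB A _ y n c1 (cy n).
  split; last by rewrite t2 t1 !subrK.
  have := transform_tail A z n p M d (AM n) d0 (fun k _ => zd k) c2.
  rewrite /series /= big_nat big1 ?subr0 => [h|k /andP[_ kp]].
    exact: le_trans dM.
  by rewrite zE ?linear0// inE; right.
have J1 : J [set n | e / 3 <= `|transform A y n - 0|].
  by move/(ideal_limP _ _ _ hJ): y0; apply; rewrite divr_gt0.
have J2 : J [set n | e / 3 <= `|transform A (fun=> eta) n - T eta|].
  by move/(ideal_limP _ _ _ hJ): (T4' eta); apply; rewrite divr_gt0.
apply: (ideal_subset hJ) (ideal_setU hJ J1 J2) => n /= en.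
have [ay|ay] := leP (e / 3) `|transform A y n - 0|; first by left.
right; rewrite /= leNgt; apply/negP => aeta.
have [az axE] := Az n; move: en; rewrite axE -addrA -addrA.
move: ay; rewrite subr0 => ay.
have := ler_normD (transform A z n)
  (transform A y n + (transform A (fun=> eta) n - T eta)).
have := ler_normD (transform A y n) (transform A (fun=> eta) n - T eta).
lra.
Qed.

Lemma conditions_regular I J T A p : is_ideal I -> is_ideal J ->
  regularity_conditions I J T A p -> regular I J T A.
Proof.
move=> hI hJ cA; split=> [x xcb|x xcb eta]; last first.
  exact: conditions_lim hI hJ cA xcb.
split; first by move=> n; exact: cond_T3 cA _ _ xcb.
split; last exact: conditions_bounded cA xcb.
by have [[eta xeta] _] := xcb; exists (T eta); apply: conditions_lim cA _ _.
Qed.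

End Regularity.

Theorem theorem2p5 (R : realType) (X Y : completeNormedModType R)
    (T : {linear X -> Y}) (I J : set (set nat))
    (hI : is_ideal I) (hJ : is_ideal J)
    (A : nat -> nat -> {linear X -> Y}) :
  (regular I J T A <-> exists k0 : nat, regularity_conditions I J T A k0) /\
  ((forall n k, bounded_fun_norm (A n k)) ->
   (regular I J T A <-> regularity_conditions I J T A 0)).
Proof.
split=> [|Abnd]; split.
- move=> Areg; have [p AM] := regular_tail_bound I J T A hI Areg.
  by exists p; exact: regular_conditions.
- by move=> [p]; exact: conditions_regular.
- move=> Areg; apply: regular_conditions => //.
  have [p [M AM]] := regular_tail_bound I J T A hI Areg.
  elim: p M AM => [|p IH] M AM; first by exists M.
  have [C AC] := column_bound (fun n => A n p) (fun n => Abnd n p)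
    (regular_column_bounded I J T A p hI Areg).
  exact: IH (tail_bound_prev A p M C AM AC).
- exact: conditions_regular.
Qed.
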